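(* Let $X$ be an infinite-dimensional real Banach space. Suppose that the dual ball $B_{X^*}$ is $w^*$-sequentially compact or, more generally, that every separable subspace of $X$ is a subspace of a complemented subspace $Y$ of $X$ whose dual ball $B_{Y^*}$ is $w^*$-sequentially compact. Then the following are equivalent. (a) $WH_{\mathrm{conv}} = H_{\mathrm{conv}}$; that is, for every continuous convex function $f: X\to\mathbb{R}$ and every $x\in X$, $f$ is $WH$-differentiable at $x$ if and only if $f$ is $H$-differentiable at $x$. (b) $X$ has the Schur property.
   Context: Let $\mathcal{B}$ be a bornology on $X$, i.e. a family of bounded subsets of $X$ whose union is $X$. A function $f: X\to\mathbb{R}$ is $\mathcal{B}$-differentiable at $x\in X$ if there is $\Lambda\in X^*$ such that for each $B\in\mathcal{B}$, $\frac{1}{t}\bigl[f(x+th)-f(x)-\langle\Lambda,th\rangle\bigr]\to 0$ as $t\downarrow 0$, uniformly for $h\in B$. The bornologies used here are $H$ (all norm compact subsets of $X$) and $WH$ (all weakly compact subsets of $X$). For locally Lipschitz functions, in particular for continuous convex functions, $H$-differentiability coincides with Gateaux differentiability. $X$ has the Schur property if every weakly convergent sequence in $X$ is norm convergent. $B_{Y^*}$ denotes the closed unit ball of $Y^*$. *)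

(* Defs.v *)
From HB Require Import structures.
From mathcomp Require Import all_boot all_order all_algebra.
From mathcomp Require Import all_classical all_reals all_analysis.

Set Implicit Arguments.
Unset Strict Implicit.
Unset Printing Implicit Defensive.

Import Order.TTheory GRing.Theory Num.Theory.
Import numFieldNormedType.Exports.

Local Open Scope classical_set_scope.
Local Open Scope ring_scope.

Section dual_space.
Context {R : realType} (V : normedModType R).

Record dual := Dual {
  dual_lin :> {linear V -> R^o};
  dual_continuous : continuous (dual_lin : V -> R^o) }.

HB.instance Definition _ := gen_eqMixin dual.
HB.instance Definition _ := gen_choiceMixin dual.

Definition dual_norm (g : dual) : R :=
  sup [set `|g x| | x in [set x : V | `|x| <= 1]].

Definition dual_ball : set dual := [set g | dual_norm g <= 1].

(* The weak topology of V, i.e. the coarsest topology for which all elements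
   of the dual are continuous. *)
Definition weak_eval (x : V) : {ptws dual -> R^o} := fun g => g x.
Definition weak : Type := initial_topology weak_eval.
HB.instance Definition _ := Topological.copy weak (initial_topology weak_eval).
HB.instance Definition _ := isPointed.Build weak (0 : V).

(* The w*-topology of the dual: pointwise convergence on V. *)
Definition weak_star_eval (g : dual) : {ptws V -> R^o} := fun x => g x.
Definition weak_star : Type := initial_topology weak_star_eval.
HB.instance Definition _ :=
  Topological.copy weak_star (initial_topology weak_star_eval).

End dual_space.
Arguments dual_norm {R V} g.
Arguments dual_ball {R} V.
Arguments weak {R} V.
Arguments weak_star {R} V.

Definition sequentially_compact {T : topologicalType} (A : set T) :=
  forall u : nat -> T, (forall n, A (u n)) ->
    exists2 s : nat -> nat, {homo s : m n / (m < n)%N} &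
      exists2 l : T, A l & u (s n) @[n --> \oo] --> l.

Definition dual_ball_wstar_seq_compact {R : realType} (V : normedModType R) :=
  sequentially_compact (dual_ball V : set (weak_star V)).

Definition separable (T : topologicalType) :=
  exists2 D : set T, countable D & dense D.

Record closed_subspace {R : realType} (V : normedModType R) := ClosedSubspace {
  subspace_set :> set V;
  subspace_submod : GRing.submod_closed (mem subspace_set : {pred V});
  subspace_closed : closed subspace_set }.

Section subspace_normed.
Context {R : realType} {V : normedModType R} (Y : closed_subspace V).

Definition subspace_pred : {pred V} := mem (subspace_set Y).
HB.instance Definition _ :=
  GRing.isSubmodClosed.Build R V subspace_pred (subspace_submod Y).

Record subspace_type := SubspaceType {
  subspace_val : V;
  subspace_valP : subspace_val \in subspace_pred }.

HB.instance Definition _ := [isSub for subspace_val].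
HB.instance Definition _ := [Choice of subspace_type by <:].
HB.instance Definition _ := [SubChoice_isSubLmodule of subspace_type by <:].

Let norm (y : subspace_type) : R := `|subspace_val y|.

Let ler_normD (x y : subspace_type) : norm (x + y) <= norm x + norm y.
Proof. exact: ler_normD. Qed.

Let normrZ (l : R) (x : subspace_type) : norm (l *: x) = `|l| * norm x.
Proof. exact: normrZ. Qed.

Let normr0_eq0 (x : subspace_type) : norm x = 0 -> x = 0.
Proof. by move=> /normr0_eq0 x0; apply/val_inj. Qed.

HB.instance Definition _ :=
  Lmodule_isNormed.Build R subspace_type ler_normD normrZ normr0_eq0.

End subspace_normed.

(* Y is the range of a bounded linear projection, equivalently it has a closed
   algebraic complement when V is a Banach space. *)
Definition complemented {R : realType} {V : normedModType R}
    (Y : closed_subspace V) :=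
  exists P : {linear V -> V},
    [/\ continuous P, forall x, P (P x) = P x & range P = Y].

Definition finite_dimensional {R : realType} (V : lmodType R) :=
  exists (n : nat) (e : 'I_n -> V), forall x : V,
    exists c : 'I_n -> R, x = \sum_(i < n) c i *: e i.

Section differentiability.
Context {R : realType} {X : normedModType R}.

(* Meant for a bornology B; the formula makes sense for any family of sets. *)
Definition bornology_differentiable (B : set (set X)) (f : X -> R) (x : X) :=
  exists L : dual X, forall A, B A ->
    {uniform A,
      (fun t (h : X) => t^-1 * (f (x + t *: h) - f x - L (t *: h)) : R)
        @ (0 : R)^'+ --> (fun _ : X => 0 : R)}.

Definition norm_compacts : set (set X) := [set A | compact A].

Definition weak_compacts : set (set X) := [set A | compact (A : set (weak X))].

(* Usually written B1_conv = B2_conv. *)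
Definition same_convex_differentiability (B1 B2 : set (set X)) :=
  forall f : X -> R, continuous f -> convex_function setT f ->
    forall x, bornology_differentiable B1 f x <-> bornology_differentiable B2 f x.

End differentiability.
Arguments norm_compacts {R} X.
Arguments weak_compacts {R} X.

Definition schur_property {R : realType} (X : normedModType R) :=
  forall u : nat -> X, cvgn (u : nat -> weak X) -> cvgn u.

(* Main.v *)
Require Import Defs.
From HB Require Import structures.
From mathcomp Require Import all_boot all_order all_algebra.
From mathcomp Require Import all_classical all_reals all_analysis.
From mathcomp Require Import lra.
Import numFieldNormedType.Exports.
Local Open Scope classical_set_scope.

Set Implicit Arguments.
Unset Strict Implicit.
Unset Printing Implicit Defensive.

Import Order.TTheory GRing.Theory Num.Theory.
Local Open Scope ring_scope.

(* If [X] has the Schur property, a sequence of directions in a weakly compact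
   set along which the difference quotients fail to converge uniformly has a
   weakly convergent (Eberlein-Smulian), hence norm convergent, subsequence,
   whose range with its limit is norm compact: this contradicts
   H-differentiability.

   If [X] is not Schur, take a weakly null sequence [y_n] with [|y_n| >= e] and
   norming functionals for [y_n], viewed on the complemented subspace [Y].  A
   w*-convergent subsequence minus its limit, composed with the projection onto
   [Y], is a bounded w*-null sequence [g_n] with [g_n(y_(s n)) >= e / 2]
   eventually.  The convex function [sup (0, sup_n (g_n - 1 / (n + 1)))] is then
   Gateaux differentiable at [0], but not uniformly on the weakly compact set
   made of the [y_(s n)] and [0]. *)

(** * Hahn-Banach theorem for sublinear functionals *)

Section hahn_banach.
Context {R : realType} {V : lmodType R}.
Implicit Types (p q : V -> R) (x y : V).

Definition sublinear p :=
  (forall x y, p (x + y) <= p x + p y) /\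
  (forall a x, 0 <= a -> p (a *: x) <= a * p x).

Lemma sublinear_ge0 p : sublinear p -> 0 <= p 0.
Proof. by case=> pD _; have := pD 0 0; rewrite addr0 -subr_ge0 addrK. Qed.

Lemma sublinear0 p : sublinear p -> p 0 = 0.
Proof.
move=> sp; apply/le_anti; rewrite sublinear_ge0// andbT.
by have := sp.2 0 0 (lexx _); rewrite scale0r mul0r.
Qed.

Lemma sublinearZ p a x : sublinear p -> 0 <= a -> p (a *: x) = a * p x.
Proof.
move=> sp; rewrite le_eqVlt => /orP[/eqP<-|a0].
  by rewrite scale0r mul0r sublinear0.
apply/le_anti; rewrite sp.2 ?(ltW a0)//=.
rewrite -ler_pdivlMl//; apply: le_trans (sp.2 _ _ _); last first.
  by rewrite invr_ge0 ltW.
by rewrite scalerA mulVf ?scale1r// gt_eqF.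
Qed.

Lemma sublinear_geN p x : sublinear p -> - p (- x) <= p x.
Proof.
move=> sp; rewrite lerNl -subr_ge0 opprK.
by rewrite -(sublinear0 sp) -[in p 0](addNr x) sp.1.
Qed.

(** For sublinear [p], this is the largest sublinear functional below [p] whose value at [- y] is at
    most [- p y]. *)
Definition tilt p y x : R :=
  inf [set p (x + t *: y) - t * p y | t in [set t | 0 <= t]].

Lemma tilt_le p y x t : sublinear p -> 0 <= t ->
  tilt p y x <= p (x + t *: y) - t * p y.
Proof.
move=> sp t0; apply: ge_inf; last by exists t.
(* [s * p y = p (s *: y) <= p (x + s *: y) + p (- x)] bounds the infimum from below. *)
exists (- p (- x)) => _ [s s0 <-].
rewrite lerBrDr addrC lerBlDr -sublinearZ//.
by apply: le_trans (sp.1 _ _); rewrite addrAC subrr add0r.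
Qed.

Lemma le_tilt p y x (c : R) :
  (forall t : R, 0 <= t -> c <= p (x + t *: y) - t * p y) -> c <= tilt p y x.
Proof.
move=> h; apply: lb_le_inf; last by move=> _ [t t0 <-]; exact: h.
by exists (p (x + 0 *: y) - 0 * p y); exists 0 => //=.
Qed.

Lemma tilt_sublinear p y : sublinear p -> sublinear (tilt p y).
Proof.
move=> sp; split=> [x z|a x a0].
  rewrite -lerBlDr; apply: le_tilt => t t0; rewrite lerBlDr -lerBlDl.
  apply: le_tilt => s s0; rewrite lerBlDr.
  apply: le_trans (tilt_le y (x + z) sp (addr_ge0 t0 s0)) _.
  have := sp.1 (x + t *: y) (z + s *: y); rewrite addrACA -scalerDl; lra.
move: a0; rewrite le_eqVlt => /orP[/eqP<-|a0].
  rewrite scale0r mul0r; apply: le_trans (tilt_le y 0 sp (lexx _)) _.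
  by rewrite scale0r mul0r addr0 subr0 sublinear0.
rewrite -ler_pdivrMl//; apply: le_tilt => t t0; rewrite ler_pdivrMl//.
apply: le_trans (tilt_le y _ sp (mulr_ge0 (ltW a0) t0)) _.
by rewrite -scalerA -scalerDr (sublinearZ _ sp (ltW a0)) mulrBr mulrA.
Qed.

Lemma tilt_le_self p y x : sublinear p -> tilt p y x <= p x.
Proof.
move=> sp; apply: le_trans (tilt_le y x sp (lexx _)) _.
by rewrite scale0r mul0r addr0 subr0.
Qed.

(** Zorn's lemma for the reversed pointwise order: a nonempty chain is bounded by its pointwise
    infimum, which is finite because each member [r] satisfies [- p (- x) <= r x]. *)
Lemma minimal_sublinear p : sublinear p -> exists q,
  [/\ sublinear q, forall x, q x <= p x
    & forall q', sublinear q' -> (forall x, q' x <= q x) -> q' = q].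
Proof.
move=> sp; pose T := {q | sublinear q /\ forall x, q x <= p x}.
pose D (q q' : T) := `[< forall x, sval q' x <= sval q x >].
have : exists q : T, forall r, D q r -> r = q.
  apply: Zorn.
  - by move=> q; apply/asboolP => x.
  - move=> r s t /asboolP rs /asboolP st; apply/asboolP => x.
    exact: le_trans (st x) (rs x).
  - move=> [s Ps] [t Pt] /asboolP st /asboolP ts; apply: eq_exist.
    by apply/funext => x; apply/le_anti; rewrite st ts.
  move=> A Atot; have [[q0 Aq0]|A0] := pselect (A !=set0); last first.
    exists (exist _ p (conj sp (fun x => lexx (p x)))) => s As.
    by case: A0; exists s.
  pose m x := inf [set sval r x | r in A].
  have lem (q : T) x : A q -> m x <= sval q x.
    move=> Aq; apply: ge_inf; last by exists q.
    exists (- p (- x)) => _ [r Ar <-].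
    apply: le_trans (sublinear_geN _ (svalP r).1).
    by rewrite lerN2; exact: (svalP r).2.
  have mle x c : (forall q : T, A q -> c <= sval q x) -> c <= m x.
    move=> h; apply: lb_le_inf; last by move=> _ [q Aq <-]; exact: h.
    by exists (sval q0 x); exists q0.
  have sm : sublinear m.
    split=> [x z|a x a0].
      rewrite -lerBlDr; apply: (mle _ _) => q Aq; rewrite lerBlDr -lerBlDl.
      apply: (mle _ _) => r Ar; rewrite lerBlDr.
      (* Of two members of the chain, the smaller one serves for both [x] and [z]. *)
      have [/asboolP qr|/asboolP rq] := Atot _ _ Aq Ar.
        apply: le_trans (lem r _ Ar) _; apply: le_trans ((svalP r).1.1 _ _) _.
        by rewrite addrC lerD2l.
      apply: le_trans (lem q _ Aq) _; apply: le_trans ((svalP q).1.1 _ _) _.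
      by rewrite addrC lerD2r.
    move: a0; rewrite le_eqVlt => /orP[/eqP<-|a0].
      rewrite scale0r mul0r -(sublinear0 (svalP q0).1); exact: lem.
    rewrite -ler_pdivrMl//; apply: (mle _ _) => q Aq; rewrite ler_pdivrMl//.
    apply: le_trans (lem q _ Aq) _; exact: (svalP q).1.2 (ltW a0).
  have mp x : m x <= p x by exact: le_trans (lem _ _ Aq0) ((svalP q0).2 x).
  exists (exist _ m (conj sm mp)) => s As; apply/asboolP => x /=; exact: lem.
case=> -[q [sq qp]] qmin; exists q; split=> // q' sq' q'q.
have q'p x : q' x <= p x by exact: le_trans (q'q x) (qp x).
have /(_ _)/(congr1 sval)/= := qmin (exist _ q' (conj sq' q'p)).
by apply; apply/asboolP.
Qed.

(* A minimal sublinear functional equals each of its tilts, which makes it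
   superadditive and hence linear; tilting [p] along [y] first fixes the value
   at [y]. *)
Lemma hahn_banach p y : sublinear p -> exists f : {linear V -> R^o},
  (forall x, f x <= p x) /\ f y = p y.
Proof.
move=> sp; have [q [sq qp qmin]] := minimal_sublinear (tilt_sublinear y sp).
have qD : {morph q : x z / x + z >-> x + z}.
  move=> x z; apply/le_anti; rewrite sq.1/=.
  have := tilt_le z x sq ler01.
  rewrite (qmin _ (tilt_sublinear z sq)); last by move=> ?; exact: tilt_le_self.
  by rewrite scale1r mul1r lerBrDr.
have qN x : q (- x) = - q x.
  by apply/eqP; rewrite -addr_eq0 -qD addNr sublinear0.
have ql : scalable (q : V -> R^o).
  move=> a x; have [a0|/ltW a0] := leP 0 a; first exact: sublinearZ.
  by rewrite -[a *: x]opprK -scaleNr qN sublinearZ ?oppr_ge0// mulNr opprK.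
pose F : V -> R^o := q.
have Fl : linear F by move=> a x z; rewrite /F qD ql.
pose f : {linear V -> R^o} :=
  HB.pack F (GRing.isLinear.Build _ _ _ _ F Fl).
exists f; split=> [x|]; first exact: le_trans (qp x) (tilt_le_self _ _ sp).
apply/le_anti/andP; split; first exact: le_trans (qp y) (tilt_le_self _ _ sp).
rewrite -lerN2 -[- f y]qN; apply: le_trans (qp (- y)) _.
apply: le_trans (tilt_le y _ sp ler01) _.
by rewrite scale1r mul1r addNr sublinear0// sub0r.
Qed.

End hahn_banach.

(** * Initial topologies, pointwise convergence and compactness *)

Section topology.

Lemma cvg_initial (S : choiceType) (T : topologicalType) (f : S -> T)
    (F : set_system S) (s : S) : Filter F ->
  F --> (s : initial_topology f) <-> f @ F --> f s.
Proof.
move=> FF; split=> [Fs|fFs].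
  apply: (@cvg_comp _ (initial_topology f) _ id); first exact: Fs.
  exact: initial_continuous.
move=> B; rewrite nbhsE => -[_ [[U oU <-] Us] UB].
by apply: filterS UB _; apply: fFs; exact: open_nbhs_nbhs.
Qed.

Lemma cvg_ptws (U : Type) (T : topologicalType) (F : set_system (U -> T))
    (f : U -> T) : Filter F ->
  F --> (f : {ptws U -> T}) <-> forall u, h u @[h --> F] --> f u.
Proof.
by move=> FF; rewrite cvg_sup; split=> Ff u; apply/cvg_initial; exact: Ff.
Qed.

(** A neighbourhood of [l] misses only finitely many terms, and finite sets are compact. This serves
    for the norm topology and for the weak one. *)
Lemma compact_cvg_range (T : topologicalType) (u : nat -> T) (l : T) :
  u @ \oo --> l -> compact (range u `|` [set l]).
Proof.
move=> ul; apply/compact_near_coveringP => I F P FF cover.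
have [[U W] /= [Ul FW] UWP] := cover l (or_intror erefl).
have [N _ NU] := ul _ Ul.
have /compact_near_coveringP/(_ I F P FF) : compact (u @` `I_N).
  by apply: finite_compact; apply: finite_image; exact: finite_II.
have uN x : (u @` `I_N) x -> \forall x' \near x & i \near F, P i x'.
  by move=> [n _ <-]; apply: cover; left; exists n.
move=> /(_ uN) FN; near=> i => _ [[n _ <-]|->].
  have [nN|Nn] := ltnP n N; first by apply: (near FN i) => //; exists n.
  apply: (UWP (u n, i)); split; last exact: (near FW i).
  exact: NU.
apply: (UWP (l, i)); split; first exact: nbhs_singleton.
exact: (near FW i).
Unshelve. all: by end_near. Qed.

End topology.

(** * Hahn-Banach in the dual, and weak convergence *)

Section duality.
Context {R : realType} {V : normedModType R}.

(** The one-sided bound suffices: applied to [- x], it bounds [f x] from below. *)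
Lemma dual_of_le (f : {linear V -> R^o}) (C : R) :
  (forall x, f x <= C * `|x|) -> exists g : dual V, g =1 f.
Proof.
move=> fC; have fC' x : `|f x| <= C * `|x|.
  by rewrite ler_norml fC andbT lerNl -linearN -normrN fC.
have fc : continuous f.
  apply: bounded_linear_continuous; apply/linear_boundedP.
  exists C; split=> [|r Cr x]; first exact: num_real.
  by apply: le_trans (fC' x) _; rewrite ler_wpM2r// ltW.
by exists (Dual fc).
Qed.

Lemma dual_bounded (g : dual V) :
  exists2 C, 0 < C & forall x, `|g x| <= C * `|x|.
Proof.
have /linear_bounded_continuous/linear_boundedP := @dual_continuous _ _ g.
by move=> /pinfty_ex_gt0.
Qed.

Lemma norming_functional (x : V) :
  exists g : dual V, (forall z, `|g z| <= `|z|) /\ g x = `|x|.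
Proof.
have sn : sublinear (fun z : V => `|z|).
  split=> [y z|a y a0]; first exact: ler_normD.
  by rewrite normrZ ger0_norm.
have [f [fn fx]] := hahn_banach x sn.
have [g gf] : exists g : dual V, g =1 f.
  by apply: (@dual_of_le f 1) => z; rewrite mul1r.
exists g; rewrite gf; split=> // z.
by rewrite gf ler_norml fn andbT lerNl -linearN -normrN fn.
Qed.

Lemma closed_subspace0 (S : closed_subspace V) : subspace_set S 0.
Proof. by apply: set_mem; exact: (subspace_submod S).1. Qed.

Lemma closed_subspace_linear (S : closed_subspace V) a x y :
  subspace_set S x -> subspace_set S y -> subspace_set S (a *: x + y).
Proof.
move=> Sx Sy; apply: set_mem; apply: (subspace_submod S).2; exact: mem_set.
Qed.

Lemma closed_subspaceZ (S : closed_subspace V) a x :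
  subspace_set S x -> subspace_set S (a *: x).
Proof.
move=> Sx; rewrite -[_ *: _]addr0; apply: closed_subspace_linear => //.
exact: closed_subspace0.
Qed.

(** Hahn-Banach is applied to the distance to [S], a sublinear functional dominated by the norm; the
    resulting functional agrees with it at [y]. *)
Lemma annihilating_functional (S : closed_subspace V) (y : V) :
  ~ subspace_set S y ->
  exists g : dual V, (forall z, subspace_set S z -> g z = 0) /\ g y != 0.
Proof.
move=> Sy; pose p (x : V) := inf [set `|x - z| | z in S].
have p_le x z : subspace_set S z -> p x <= `|x - z|.
  by move=> Sz; apply: ge_inf; [exists 0 => _ [w _ <-]|exists z].
have le_p x (c : R) : (forall z, subspace_set S z -> c <= `|x - z|) -> c <= p x.
  move=> h; apply: lb_le_inf; last by move=> _ [z Sz <-]; exact: h.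
  by exists `|x - 0|; exists 0 => //; exact: closed_subspace0.
have p_norm x : p x <= `|x|.
  by have := p_le x 0 (closed_subspace0 S); rewrite subr0.
have p0 z : subspace_set S z -> p z <= 0.
  by move=> /(p_le z); rewrite subrr normr0.
have sp : sublinear p.
  split=> [x z|a x].
    rewrite -lerBlDr; apply: (le_p x _) => w Sw; rewrite lerBlDr -lerBlDl.
    apply: (le_p z _) => v Sv; rewrite lerBlDl.
    have Swv : subspace_set S (w + v).
      by rewrite -[w]scale1r; exact: closed_subspace_linear.
    apply: le_trans (p_le _ _ Swv) _.
    by rewrite opprD addrACA; exact: ler_normD.
  rewrite le_eqVlt => /orP[/eqP<-|a0].
    by rewrite scale0r mul0r p0//; exact: closed_subspace0.
  rewrite -ler_pdivrMl//; apply: (le_p x _) => w Sw; rewrite ler_pdivrMl//.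
  have Saw := closed_subspaceZ a Sw.
  apply: le_trans (p_le _ _ Saw) _.
  by rewrite -scalerBr normrZ gtr0_norm.
(* Since [S] is closed, some ball around [y] misses it, and its radius bounds the distance from
   below. *)
have py : 0 < p y.
  have : ~ closure S y by rewrite -(closure_id S).1//; exact: subspace_closed.
  move=> /existsNP[B] /not_implyP[/nbhs_ballP[e /= e0 eB] SB].
  apply: lt_le_trans e0 _; apply: (le_p y e) => z Sz.
  rewrite leNgt; apply/negP => yze; apply: SB; exists z; split=> //.
  by apply: eB; rewrite -ball_normE.
have [f [fp fy]] := hahn_banach y sp.
have [g gf] : exists g : dual V, g =1 f.
  apply: (@dual_of_le f 1) => z; rewrite mul1r.
  exact: le_trans (fp z) (p_norm z).
exists g; split=> [z Sz|]; last by rewrite gf fy gt_eqF.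
(* The distance is at most 0 on [S], so [f] is nonpositive at both [z] and [- z]. *)
apply/le_anti; rewrite !gf (le_trans (fp z) (p0 _ Sz))/=.
rewrite -oppr_le0 -linearN (le_trans (fp _))// p0//.
by rewrite -scaleN1r; exact: closed_subspaceZ.
Qed.

Lemma weak_cvgP (F : set_system V) (l : V) : Filter F ->
  F --> (l : weak V) <-> forall g : dual V, g @ F --> g l.
Proof.
move=> FF; rewrite cvg_initial cvg_ptws; split=> h g; exact: h.
Qed.

Lemma weak_star_cvgP (F : set_system (dual V)) (l : dual V) : Filter F ->
  F --> (l : weak_star V) <-> forall x, g x @[g --> F] --> l x.
Proof.
move=> FF; rewrite cvg_initial cvg_ptws; split=> h g; exact: h.
Qed.

Lemma weak_continuous (g : dual V) (x : V) :
  g y @[y --> (x : weak V)] --> (g x : R^o).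
Proof. by move: g; apply/(@weak_cvgP (nbhs (x : weak V))). Qed.

(** The weak topology is coarser than the norm topology, so a norm cluster point is a weak one. *)
Lemma compact_weak (A : set V) : compact A -> compact (A : set (weak V)).
Proof.
move=> cA F PF FA; have [x [Ax Fx]] := cA F PF FA; exists x; split=> //.
move=> B W FB xW; apply: Fx => //.
have : nbhs x --> (x : weak V) by apply/weak_cvgP => g; exact: dual_continuous.
exact.
Qed.

End duality.

(** * The separable closed span of a sequence *)

Section closed_span.
Context {R : realType} {V : normedModType R} (u : nat -> V).
Implicit Types p q : {poly rat}.

(* Polynomials over [rat] encode the countably many finite rational
   combinations of the terms of [u]. *)
Definition rat_comb p : V := \sum_(i < size p) ratr p`_i *: u i.

Lemma rat_comb_widen n p : (size p <= n)%N ->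
  rat_comb p = \sum_(i < n) ratr p`_i *: u i.
Proof.
move=> pn; rewrite /rat_comb (big_ord_widen n (fun i => ratr p`_i *: u i))//.
rewrite [RHS](bigID (fun i : 'I_n => (i < size p)%N))/=.
rewrite [X in _ = _ + X]big1 ?addr0//.
by move=> i; rewrite -leqNgt => /(nth_default 0) ->; rewrite rmorph0 scale0r.
Qed.

Lemma rat_combD p q : rat_comb (p + q) = rat_comb p + rat_comb q.
Proof.
rewrite (@rat_comb_widen (maxn (size p) (size q)) (p + q)) ?size_polyD//.
rewrite (rat_comb_widen (leq_maxl _ (size q))).
rewrite (rat_comb_widen (leq_maxr (size p) _)).
by rewrite -big_split/=; apply: eq_bigr => i _; rewrite coefD raddfD scalerDl.
Qed.

Lemma rat_combZ (a : rat) p : rat_comb (a *: p) = ratr a *: rat_comb p.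
Proof.
rewrite (rat_comb_widen (size_scale_leq a p)) scaler_sumr.
by apply: eq_bigr => i _; rewrite coefZ rmorphM scalerA.
Qed.

Lemma rat_combX n : rat_comb 'X^n = u n.
Proof.
rewrite /rat_comb size_polyXn big_ord_recr/= big1 => [|i _].
  by rewrite add0r coefXn eqxx rmorph1 scale1r.
by rewrite coefXn ltn_eqF// rmorph0 scale0r.
Qed.

(** Real scalars are reached by density of the rationals and joint continuity of [a *: x + y] in
    [a], [x] and [y]. *)
Lemma closure_rat_comb_submod :
  GRing.submod_closed (mem (closure (range rat_comb)) : {pred V}).
Proof.
split=> [|a x y /set_mem xS /set_mem yS]; apply: mem_set.
  by apply: subset_closure; exists 0 => //;
    rewrite /rat_comb size_poly0 big_ord0.
have cxy : (z.1.1 *: z.1.2 + z.2 : V) @[z --> (a, x, y)] --> a *: x + y.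
  apply: cvgD; last exact: cvg_snd.
  apply: cvgZ; first by apply: cvg_comp cvg_fst _; exact: cvg_fst.
  by apply: cvg_comp cvg_fst _; exact: cvg_snd.
move=> B /cxy[/= [U W]] /= [[[U1 U2] /= [aU1 xU2] U12] yW] UWB.
have [_ [[p _ <-] pU]] := xS _ xU2; have [_ [[q _ <-] qW]] := yS _ yW.
have [_ [/[swap] -[c _ <-] cU]] : U1^° `&` range ratr !=set0.
  by apply: dense_rat; [exists a|exact: open_interior].
move/interior_subset in cU.
exists (ratr c *: rat_comb p + rat_comb q); split.
  by exists (c *: p + q) => //; rewrite rat_combD rat_combZ.
by apply: (UWB (ratr c, rat_comb p, rat_comb q)); split => //; apply: U12.
Qed.

Definition closed_span : closed_subspace V :=
  ClosedSubspace closure_rat_comb_submod (@closed_closure _ _).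

Lemma closed_span_gen n : subspace_set closed_span (u n).
Proof. by apply: subset_closure; exists 'X^n => //; rewrite rat_combX. Qed.

Lemma rat_comb_closed_span p : rat_comb p \in subspace_pred closed_span.
Proof. by apply: mem_set; apply: subset_closure; exists p. Qed.

Lemma separable_closed_span : separable (subspace_type closed_span).
Proof.
exists (range (fun p => SubspaceType (rat_comb_closed_span p))).
  exact: sub_countable (card_image_le _ _) (countableP _).
move=> O [y Oy] oO.
have /nbhs_ballP[e /= e0 eO] : nbhs y O by exact: open_nbhs_nbhs.
have [? []] := set_mem (subspace_valP y) _ (nbhsx_ballx (subspace_val y) e e0).
move=> [p _ <-] pe; exists (SubspaceType (rat_comb_closed_span p)).
split; last by exists p.
by apply: eO; rewrite -ball_normE; move: pe; rewrite -ball_normE.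
Qed.

End closed_span.

(** * Eberlein-Smulian: sequences in weakly compact sets *)

Section eberlein_smulian.
Context {R : realType} {V : normedModType R}.

(** The functionals norm the countably many rational combinations. If such a combination [p] is
    within [|z| / 2] of [z], its functional is at least [|p| - |z - p| > 0] at [z]. *)
Lemma closed_span_norming (u : nat -> V) : exists phi : nat -> dual V,
  forall z, subspace_set (closed_span u) z -> z != 0 -> exists k, phi k z != 0.
Proof.
have /choice[f fP] (p : {poly rat}) := norming_functional (rat_comb u p).
(* The default [0] only fills the indices that encode no polynomial. *)
exists (fun k => f (odflt 0 (unpickle k))) => z Sz z0.
have e0 : 0 < `|z| / 2 by rewrite divr_gt0 ?normr_gt0.
have [? []] := Sz _ (nbhsx_ballx z _ e0); move=> [p _ <-].
rewrite -ball_normE/= => zp; exists (pickle p); rewrite pickleK/=.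
have [fle fp] := fP p; rewrite gt_eqF//.
have := fle (z - rat_comb u p); rewrite ler_norml => /andP[+ _].
rewrite linearB/= fp lerBrDr.
have := ler_normD (z - rat_comb u p) (rat_comb u p); rewrite subrK.
lra.
Qed.

(** Countably many functionals separate the points of the closed span of [u]. Along a suitable [s]
    they all converge to their values at a weak cluster point [y], and compactness turns this into
    weak convergence. The bound [n <= s n] suffices to send [s] to infinity. *)
Lemma weak_compact_subseq (A : set V) (u : nat -> V) :
  compact (A : set (weak V)) -> (forall n, A (u n)) ->
  exists (s : nat -> nat) (y : V), [/\ A y, forall n, (n <= s n)%N
    & u (s n) @[n --> \oo] --> (y : weak V)].
Proof.
move=> cA Au; pose S := closed_span u.
have [phi phiS] := closed_span_norming u.
have [y [Ay yu]] : A `&` cluster ((u : nat -> weak V) @ \oo) !=set0.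
  by apply: cA; exists 0%N => // n _; exact: Au.
(* Otherwise a functional vanishing on the span would keep every [u n] out of a weak neighbourhood
   of [y]. *)
have Sy : subspace_set S y.
  apply: contrapT => /annihilating_functional[g [gS gy]].
  rewrite -normr_gt0 in gy.
  have /cvgrPdist_lt/(_ _ gy) := @weak_continuous _ _ g y.
  move=> /(yu (range u)) []; first by exists 0%N => // n _; exists n.
  move=> _ [[n _ <-] /=]; rewrite (gS (u n)) ?subr0 ?ltxx//.
  exact: closed_span_gen.
(* Diagonal choice: only the first [j] functionals are constrained at stage [j], which defines a
   weak neighbourhood of the cluster point. *)
have /choice[s sP] (j : nat) : exists n, (j <= n)%N /\
    forall k, (k < j)%N -> `|phi k y - phi k (u n)| < j.+1%:R^-1.
  have : nbhs (y : weak V)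
      [set x | forall k, (k < j)%N -> `|phi k y - phi k x| < j.+1%:R^-1].
    have : \forall x \near nbhs (y : weak V), forall k : 'I_j,
        `|phi k y - phi k x| < j.+1%:R^-1.
      apply: (@filter_forall _ _ _ (nbhs (y : weak V))) => k.
      have /cvgrPdist_lt := @weak_continuous _ _ (phi k) y.
      by apply; rewrite invr_gt0.
    by apply: filterS => x xP k kj; exact: (xP (Ordinal kj)).
  move=> /(yu (u @` [set n | (j <= n)%N])) [].
    by exists j => // n /= jn; exists n.
  by move=> _ [[n jn <-] nP]; exists n.
exists s, y; split=> // [n|]; first exact: (sP n).1.
have phi_cvg k : phi k (u (s j)) @[j --> \oo] --> (phi k y : R^o).
  apply/cvgrPdist_lt => e e0; near=> j.
  apply: lt_trans ((sP j).2 k _) _; first by near: j; exact: nbhs_infty_gt.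
  by near: j; exact: near_infty_natSinv_lt (PosNum e0).
(* Inside the span some [phi k] separates [x] from [y]; outside it, a functional vanishing on the
   span does. *)
have sep x : x != y -> exists g : dual V,
    g (u (s j)) @[j --> \oo] --> (g y : R^o) /\ g x != g y.
  move=> xy; have [Sx|Sx] := pselect (subspace_set S x).
    have Sxy : subspace_set S (x - y).
      by rewrite addrC -scaleN1r; exact: closed_subspace_linear.
    have [|k] := phiS _ Sxy; first by rewrite subr_eq0.
    by rewrite linearB/= subr_eq0 => kxy; exists (phi k).
  have [g [gS gx]] := annihilating_functional Sx.
  exists g; rewrite (gS y)//; split=> //.
  have -> : (fun j => g (u (s j))) = cst 0.
    by apply/funext => j; rewrite gS//; exact: closed_span_gen.
  exact: cvg_cst.
(* Each [x] of [A] other than [y] has a weak neighbourhood that eventually contains no [u (s j)]. By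
   compactness of [A] the sequence is then eventually in [O]. *)
move=> O yO; move/compact_near_coveringP : cA.
move=> /(_ _ \oo (fun j x => x = u (s j) -> O x)) cA.
suff : \forall j \near \oo, forall x, A x -> x = u (s j) -> O x.
  by apply: filterS => j; apply.
apply: cA => x Ax.
have [->|xy] := eqVneq x y.
  by exists (O, setT) => [|[x' j] [] //]; split=> //=; exact: filterT.
have [g [gy gxy]] := sep _ xy.
have e0 : 0 < `|g x - g y| / 2 by rewrite divr_gt0 ?normr_gt0 ?subr_eq0.
exists ([set x' | `|g x - g x'| < `|g x - g y| / 2],
        [set j | `|g y - g (u (s j))| < `|g x - g y| / 2]); first split => /=.
- by have /cvgrPdist_lt/(_ _ e0) := @weak_continuous _ _ g x.
- by have /cvgrPdist_lt/(_ _ e0) := gy.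
move=> [x' j] /= [h1 h2] x'E; exfalso; rewrite x'E in h1.
have := ler_distD (g (u (s j))) (g x) (g y).
rewrite (distrC (g (u (s j))) (g y)).
rewrite leNgt => /negP; apply; lra.
Unshelve. all: by end_near. Qed.

End eberlein_smulian.

(** * Uniform differentiability under the Schur property *)

Section uniform_differentiability.
Context {R : realType} {X : normedModType R}.

Lemma uniform_cvg0P (A : set X) (F : set_system R) (q : R -> X -> R) :
  Filter F ->
  {uniform A, q @ F --> (fun _ : X => 0 : R)} <->
  forall e : R, 0 < e -> \forall t \near F, forall h, A h -> `|q t h| < e.
Proof.
move=> FF; split=> [qF e e0|qF B].
  apply: (qF [set g | forall h, A h -> `|g h| < e]).
  apply/uniform_nbhs; exists [set z | ball z.1 e z.2]; split.
    exact: entourage_ball (PosNum e0).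
  by move=> g gP h Ah; have := gP h Ah; rewrite -ball_normE/= sub0r normrN.
move=> /uniform_nbhs[E []]; rewrite -entourage_ballE => -[e /= e0 eE] EB.
apply: filterS (qF e e0) => t tP; apply: EB => h Ah; apply: eE => /=.
by rewrite -ball_normE/= sub0r normrN; exact: tP.
Qed.

Lemma schur_weak_compacts_differentiable (f : X -> R) (x : X) :
  schur_property X -> bornology_differentiable (norm_compacts X) f x ->
  bornology_differentiable (weak_compacts X) f x.
Proof.
move=> schur [L fL]; exists L => A cA; apply/uniform_cvg0P => e e0.
pose q (t : R) (h : X) : R := t^-1 * (f (x + t *: h) - f x - L (t *: h)).
have [//|notA] := pselect (\forall t \near 0^'+, forall h, A h -> `|q t h| < e).
have /choice[th thP] (n : nat) : exists th : R * X,
    [/\ 0 < th.1, th.1 < n.+1%:R^-1, A th.2 & e <= `|q th.1 th.2| ].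
  apply: contra_notP notA => h; near=> t => a Aa; rewrite ltNge.
  apply/negP => qe; apply: h; exists (t, a); split=> //=.
have [s [y [Ay sn sy]]] := @weak_compact_subseq _ _ A (fun n => (th n).2) cA
  (fun n => let: And4 _ _ Ah _ := thP n in Ah).
have /schur hz : cvgn ((fun n => (th (s n)).2) : nat -> weak X).
  by apply/cvg_ex; exists y.
have := fL _ (compact_cvg_range hz).
move=> /uniform_cvg0P/(_ e e0) qe.
have /nbhs_ballP[d /= d0 dP] := qe.
(* One index already contradicts uniformity: [N <= s N] puts its step below [N.+1^-1 < d]. *)
have [N _ /(_ N (leqnn N)) Nd] := near_infty_natSinv_lt (PosNum d0).
have [t0 tN _] := thP (s N); rewrite leNgt => /negP[].
apply: (dP (th (s N)).1) => //=; last by left; exists N.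
rewrite -ball_normE/= sub0r normrN gtr0_norm//.
apply: lt_le_trans tN (le_trans _ (ltW Nd)).
by rewrite lef_pV2 ?posrE// ler_nat ltnS.
Unshelve. all: by end_near. Qed.

Lemma norm_compacts_differentiable (f : X -> R) (x : X) :
  bornology_differentiable (weak_compacts X) f x ->
  bornology_differentiable (norm_compacts X) f x.
Proof. by move=> [L fL]; exists L => A cA; apply: fL; exact: compact_weak. Qed.

End uniform_differentiability.

(** * The convex envelope of a bounded, pointwise null sequence of functionals *)

Section envelope.
Context {R : realType} {X : normedModType R} (g : nat -> X -> R) (C : R).
Hypothesis gP : forall n a x y, g n (a *: x + y) = a * g n x + g n y.
Hypothesis C0 : 0 < C.
Hypothesis gC : forall n x, `|g n x| <= C * `|x|.
Hypothesis g0 : forall x, g n x @[n --> \oo] --> 0.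

Let gD n x y : g n (x + y) = g n x + g n y.
Proof. by rewrite -[x]scale1r gP mul1r scale1r. Qed.

Let g00 n : g n 0 = 0.
Proof. by apply: (addrI (g n 0)); rewrite -gD !addr0. Qed.

Let gZ n a x : g n (a *: x) = a * g n x.
Proof. by rewrite -[_ *: _]addr0 gP g00 addr0. Qed.

Let gB n x y : g n (x - y) = g n x - g n y.
Proof. by rewrite -scaleN1r gD gZ mulN1r. Qed.

(** The element [0] makes the origin a minimum; the offsets keep any finite number of the [g n] from
    contributing near it. *)
Definition envelope (x : X) : R :=
  sup ([set 0] `|` range (fun n => g n x - n.+1%:R^-1)).

Lemma envelope_le x (c : R) : 0 <= c ->
  (forall n, g n x - n.+1%:R^-1 <= c) -> envelope x <= c.
Proof.
move=> c0 gc; apply: ge_sup; first by exists 0; left.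
by move=> _ [->//|[n _ <-]].
Qed.

Let envelope_ub x :
  has_ubound ([set 0] `|` range (fun n => g n x - n.+1%:R^-1)).
Proof.
exists (C * `|x|) => _ [->|[n _ <-]]; first exact: le_trans (gC 0 x).
apply: le_trans (gC n x); apply: le_trans (ler_norm _).
by rewrite gerBl invr_ge0.
Qed.

Lemma le_envelope n x : g n x - n.+1%:R^-1 <= envelope x.
Proof. by apply: ub_le_sup => //; right; exists n. Qed.

Lemma envelope_ge0 x : 0 <= envelope x.
Proof. by apply: ub_le_sup => //; left. Qed.

Lemma envelope0 : envelope 0 = 0.
Proof.
apply/le_anti; rewrite envelope_ge0 andbT; apply: envelope_le => // n.
by rewrite g00 sub0r oppr_le0 invr_ge0.
Qed.

(** All the functions in the supremum have the same Lipschitz constant [C]. *)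
Lemma envelope_lipschitz x y : envelope x <= envelope y + C * `|x - y|.
Proof.
apply: envelope_le => [|n].
  by rewrite addr_ge0 ?envelope_ge0 ?mulr_ge0// ltW.
have gxy : g n x - g n y <= C * `|x - y|.
  by rewrite -gB; exact: le_trans (ler_norm _) (gC n _).
rewrite [leRHS]addrC.
by have := lerD gxy (le_envelope n y); rewrite addrA subrK.
Qed.

Lemma envelope_continuous : continuous envelope.
Proof.
move=> x; apply/cvgrPdist_lt => e e0.
near=> y.
have xy : `|x - y| < e / C.
  by near: y; apply: cvgr_dist_lt; [exact: cvg_id|rewrite divr_gt0].
rewrite ltr_pdivlMr// mulrC in xy; move: xy.
have := envelope_lipschitz x y; have := envelope_lipschitz y x.
rewrite (distrC y) ltr_norml; move: (C * _) => c h1 h2 ce.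
apply/andP; split; lra.
Unshelve. all: by end_near. Qed.

Lemma envelope_convex : convex_function setT envelope.
Proof.
move=> t x y _ _.
rewrite -[leRHS]/(t%:inum * envelope x + (1 - t%:inum) * envelope y).
have t0 : 0 <= t%:inum by [].
have t1 : 0 <= 1 - t%:inum by rewrite subr_ge0.
apply: envelope_le => [|n].
  by rewrite addr_ge0// mulr_ge0// envelope_ge0.
rewrite -[X in X - _]/(g n (t%:inum *: x + (1 - t%:inum) *: y)) gP gZ.
have := ler_wpM2l t0 (le_envelope n x); have := ler_wpM2l t1 (le_envelope n y).
move: (t%:inum) (g n x) (g n y) (n.+1%:R^-1) (envelope x) (envelope y).
move=> a b c d p q; nra.
Qed.

(* Only finitely many [g n] exceed [e] at [x], and those are cut off by
   [n.+1^-1] once [t] is small. *)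
Lemma envelope_directional x (e : R) : 0 < e ->
  \forall t \near (0 : R)^'+, envelope (t *: x) <= t * e.
Proof.
move=> e0; have /cvgrPdist_lt/(_ e e0)[N _ Ne] := @g0 x.
have M0 : 0 < C * `|x| + 1 by rewrite ltr_wpDl// mulr_ge0// ltW.
near=> t; have t0 : 0 < t by [].
apply: envelope_le => [|n]; first by rewrite mulr_ge0 ?ltW.
rewrite gZ; have [Nn|nN] := leqP N n.
  have := Ne n Nn; rewrite /= sub0r normrN ltr_norml => /andP[_ gne].
  rewrite lerBlDr ler_wpDr ?invr_ge0//.
  by rewrite ler_pM2l// ltW.
have tN : t * (C * `|x|) <= N.+1%:R^-1.
  apply: le_trans (_ : t * (C * `|x| + 1) <= _).
    by rewrite ler_pM2l// lerDl.
  rewrite -ler_pdivlMr//; near: t; apply: nbhs_right_le.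
  by rewrite divr_gt0.
apply: le_trans (_ : 0 <= _); last by rewrite mulr_ge0 ?ltW.
rewrite subr_le0; apply: le_trans (le_trans tN _).
  by rewrite ler_pM2l// (le_trans (ler_norm _))//.
by rewrite lef_pV2 ?posrE// ler_nat ltnS ltnW.
Unshelve. all: by end_near. Qed.

(** The derivative is 0. The quotients are [C]-Lipschitz in the direction, uniformly in [t], so the
    directional estimate at [x] extends to directions within [e / 2 / C], and compactness makes it
    uniform. *)
Lemma envelope_norm_compacts_differentiable :
  bornology_differentiable (norm_compacts X) envelope 0.
Proof.
have c0 : continuous (\0 : {linear X -> R^o}) by exact: cst_continuous.
exists (Dual c0) => A cA; apply/uniform_cvg0P => e e0.
move/compact_near_coveringP : cA => cA.
pose P (t : R) h :=
  `|t^-1 * (envelope (0 + t *: h) - envelope 0 - (Dual c0) (t *: h))| < e.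
have : \forall t \near (0:R)^'+, A `<=` P t.
  apply: cA => x Ax; have e2 : 0 < e / 2 by rewrite divr_gt0.
  exists ([set x' | `|x - x'| < e / 2 / C],
    [set t : R | 0 < t /\ envelope (t *: x) <= t * (e / 2)]).
    split=> /=; first by apply: cvgr_dist_lt; [exact: cvg_id|rewrite divr_gt0].
    by near=> t; split; [|near: t; exact: envelope_directional].
  move=> [x' t] /= [xx' [t0 tx]]; rewrite /P/= add0r envelope0 !subr0.
  rewrite ger0_norm ?mulr_ge0 ?envelope_ge0 ?invr_ge0 ?(ltW t0)//.
  rewrite ltr_pdivrMl//; rewrite ltr_pdivlMr// mulrC in xx'.
  apply: le_lt_trans (envelope_lipschitz _ (t *: x)) _.
  rewrite -scalerBr normrZ gtr0_norm// mulrCA distrC.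
  apply: le_lt_trans (lerD tx (lexx _)) _.
  by rewrite -mulrDr ltr_pM2l// [ltRHS]splitr ltrD2l.
exact.
Unshelve. all: by end_near. Qed.

(** Any candidate derivative [L] tends to 0 along [y], while at suitable small steps the quotients
    of the envelope in the directions [y n] stay at least [e / 2]. *)
Lemma envelope_not_weak_compacts_differentiable (y : nat -> X) (e : R) :
  0 < e -> y @ \oo --> (0 : weak X) ->
  (\forall n \near \oo, e <= g n (y n)) ->
  ~ bornology_differentiable (weak_compacts X) envelope 0.
Proof.
move=> e0 y0 [N _ gy] [L fL].
have := fL _ (@compact_cvg_range (weak X) y 0 y0).
have e4 : 0 < e / 4 by rewrite divr_gt0.
move=> /uniform_cvg0P/(_ _ e4) /nbhs_ballP[d /= d0 dP].
have Ly : L (y n) @[n --> \oo] --> (L 0 : R^o).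
  exact: ((@weak_cvgP _ _ (y @ \oo) 0 _).1 y0 L).
have /cvgrPdist_lt/(_ _ e4)[N1 _ LP] := Ly.
have [N2 _ NP] : \forall n \near \oo, n.+1%:R^-1 < d * e / 2.
  have de : 0 < d * e / 2 by rewrite divr_gt0// mulr_gt0.
  exact: near_infty_natSinv_lt (PosNum de).
pose n := maxn N (maxn N1 N2).
have {}LP : `|0 - L (y n)| < e / 4.
  by have := LP n; rewrite /= linear0; apply; rewrite !leq_max leqnn !orbT.
have {}gy : e <= g n (y n) by apply: gy; rewrite /= leq_maxl.
have {}NP : n.+1%:R^-1 < d * e / 2.
  by apply: NP; rewrite /= !leq_max leqnn !orbT.
pose a : R := n.+1%:R^-1; have a0 : 0 < a by rewrite invr_gt0.
(* With this step, [g n (t *: y n) - a >= t * e - a = a = t * (e / 2)], and [a < d * e / 2] gives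
   [t < d]. *)
pose t := a * 2 / e; have t0 : 0 < t by rewrite !divr_gt0 ?mulr_gt0.
have : `|t^-1 * (envelope (0 + t *: y n) - envelope 0 - L (t *: y n))| < e / 4.
  apply: (dP t) => //; last by left; exists n.
  rewrite -ball_normE/= sub0r normrN gtr0_norm// ltr_pdivrMr// -ltr_pdivlMr//.
rewrite add0r envelope0 subr0 linearZ/= mulrBr mulKf ?gt_eqF// ltr_norml.
move=> /andP[_]; apply/negP; rewrite -leNgt.
have : e / 2 <= t^-1 * envelope (t *: y n).
  rewrite ler_pdivlMl//; apply: le_trans (le_envelope n _).
  rewrite gZ -/a; have := ler_wpM2l (ltW t0) gy.
  have -> : t * e = a * 2 by rewrite /t divfK// gt_eqF.
  have -> : t * (e / 2) = a by rewrite mulrA /t divfK ?gt_eqF// mulfK.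
  lra.
move: LP; rewrite sub0r normrN ltr_norml => /andP[]; lra.
Qed.

End envelope.

(** * Failure of the Schur property and w*-null functionals *)

Lemma cvg_infty_ge (s : nat -> nat) : (forall n, (n <= s n)%N) ->
  s @ \oo --> \oo.
Proof.
move=> ns; apply/cvgnyPge => A; exists A => // n /= An.
exact: leq_trans An (ns n).
Qed.

Lemma dual_ball_le {R : realType} {V : normedModType R} (g : dual V) :
  (forall z, `|g z| <= `|z|) -> dual_ball V g.
Proof.
move=> gn; apply: ge_sup; first by exists `|g 0|; exists 0; rewrite /= ?normr0.
by move=> _ [z z1 <-]; exact: le_trans (gn z) z1.
Qed.

Section wstar_null_sequence.
Context {R : realType} {X Z : normedModType R} (T : {linear X -> Z}).

(** The map [T] covers both alternatives on the dual ball: it will be the identity or a projection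
    onto a complemented subspace. Subtracting the w*-limit [l] eventually costs at most [e / 2],
    because [l \o T] is in the dual of [X] and so tends to 0 along [y]. *)
Lemma wstar_null_sequence (y : nat -> X) (e : R) :
  dual_ball_wstar_seq_compact Z -> continuous T -> 0 < e ->
  y @ \oo --> (0 : weak X) -> (forall n, e <= `|T (y n)|) ->
  exists (s : nat -> nat) (g : nat -> X -> R) (C : R),
    [/\ forall n, (n <= s n)%N, 0 < C,
        forall n a x z, g n (a *: x + z) = a * g n x + g n z,
        forall n x, `|g n x| <= C * `|x|
      & (forall x, g n x @[n --> \oo] --> 0) /\
        \forall n \near \oo, e / 2 <= g n (y (s n))].
Proof.
move=> Zseq Tc e0 y0 ye.
have /choice[f fP] n := norming_functional (T (y n)).
have [s s_mono [l _ fl]] := Zseq f (fun n => dual_ball_le (fP n).1).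
have fl_cvg z : f (s n) z @[n --> \oo] --> (l z : R^o).
  exact: ((@weak_star_cvgP _ _ ((fun n => f (s n)) @ \oo) l _).1 fl).
have ns n : (n <= s n)%N.
  by elim: n => // n ih; exact: leq_ltn_trans ih (s_mono _ _ (ltnSn n)).
have [Cl Cl0 lC] := dual_bounded l.
have [M M0 TM] : exists2 M, 0 < M & forall x, `|T x| <= M * `|x|.
  have /linear_bounded_continuous/linear_boundedP := Tc.
  by move=> /pinfty_ex_gt0.
(* [f (s n)] is bounded by 1 and [l] by [Cl]; composition with [T] contributes the factor [M]. *)
exists s, (fun n x => f (s n) (T x) - l (T x)), ((1 + Cl) * M); split=> //.
- by rewrite mulr_gt0// addr_gt0.
- move=> n a x z.
  have lin (h : dual Z) : h (T (a *: x + z)) = a * h (T x) + h (T z).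
    by rewrite !linearP.
  by rewrite !lin opprD addrACA mulrBr.
- move=> n x; rewrite -mulrA; apply: le_trans (ler_normB _ _) _.
  apply: le_trans (lerD ((fP _).1 _) (lC _)) _.
  by rewrite -[X in X + _]mul1r -mulrDl ler_wpM2l// addr_ge0// ltW.
split=> [x|].
  rewrite -(subrr (l (T x))); apply: cvgB; [exact: fl_cvg|exact: cvg_cst].
have lTc : continuous ((l : {linear Z -> R^o}) \o T).
  move=> x; apply: continuous_comp; [exact: Tc|exact: dual_continuous].
have Ly : l (T (y n)) @[n --> \oo] --> (l (T 0) : R^o).
  exact: ((@weak_cvgP _ _ (y @ \oo) 0 _).1 y0 (Dual lTc)).
have e2 : 0 < e / 2 by rewrite divr_gt0.
have /cvgrPdist_lt/(_ _ e2)[N _ LN] := Ly.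
exists N => // n /= Nn.
have := LN (s n) (leq_trans Nn (ns n)).
rewrite /= linear0 linear0 sub0r normrN ltr_norml => /andP[_].
have := ye (s n); rewrite (fP (s n)).2; lra.
Qed.

End wstar_null_sequence.

Lemma not_same_convex_differentiability {R : realType} {X Z : normedModType R}
    (T : {linear X -> Z}) (y : nat -> X) (e : R) :
  dual_ball_wstar_seq_compact Z -> continuous T -> 0 < e ->
  y @ \oo --> (0 : weak X) -> (forall n, e <= `|T (y n)|) ->
  ~ same_convex_differentiability (weak_compacts X) (norm_compacts X).
Proof.
move=> Zseq Tc e0 y0 ye same.
have [s [g [C [ns C0 gP gC [g0 gy]]]]] := wstar_null_sequence Zseq Tc e0 y0 ye.
have e2 : 0 < e / 2 by rewrite divr_gt0.
have ys0 : (fun n => y (s n)) @ \oo --> (0 : weak X).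
  exact: (cvg_comp s y (cvg_infty_ge ns) y0).
apply: (envelope_not_weak_compacts_differentiable gP gC e2 ys0 gy).
apply/same; [exact: envelope_continuous C0 gC|exact: envelope_convex gP gC|].
exact: envelope_norm_compacts_differentiable C0 gC g0.
Qed.

(** The weak limit [l] cannot be a norm limit, so terms arbitrarily far out stay at distance at
    least [e] from it; their differences with [l] form [y]. *)
Lemma not_schur_sequence {R : realType} {X : normedModType R} :
  ~ schur_property X -> exists (y : nat -> X) (e : R),
    [/\ 0 < e, y @ \oo --> (0 : weak X) & forall n, e <= `|y n| ].
Proof.
move=> /existsNP[u] /not_implyP[/cvg_ex[l ul] ndivu].
have : ~ u @ \oo --> (l : X) by move=> ?; apply: ndivu; apply/cvg_ex; exists l.
move=> /cvgrPdist_lt/existsNP[e] /not_implyP[e0 nu].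
have /choice[s sP] (n : nat) : exists m, (n <= m)%N /\ e <= `|l - u m|.
  apply: contra_notP nu => h; exists n => // m /= nm.
  by rewrite ltNge; apply/negP => em; apply: h; exists m.
exists (fun n => l - u (s n)), e; split=> // [|n]; last exact: (sP n).2.
apply/weak_cvgP => g.
have -> : g 0 = g l - g l :> R^o by rewrite subrr linear0.
have us : u (s n) @[n --> \oo] --> (l : weak X).
  exact: (cvg_comp s u (cvg_infty_ge (fun n => (sP n).1)) ul).
have gu : g (u (s n)) @[n --> \oo] --> (g l : R^o).
  exact: ((@weak_cvgP _ _ ((fun n => u (s n)) @ \oo) l _).1 us g).
have -> : g @ ((fun n => l - u (s n)) @ \oo) =
    (fun n => g l - g (u (s n))) @ \oo.
  by congr (_ @ \oo); apply/funext => n /=; rewrite linearB.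
by apply: cvgB gu; exact: cvg_cst.
Qed.

(** * Projections onto complemented subspaces, and the equivalence *)

Section subspace.
Context {R : realType} {X : normedModType R} (Y : closed_subspace X).

(** [T] is the projection with codomain restricted to its range; idempotence makes it fix every
    point of [Y], whose norm is the ambient one. *)
Lemma complemented_projection : complemented Y ->
  exists T : {linear X -> subspace_type Y},
    continuous T /\ forall x, subspace_set Y x -> `|T x| = `|x|.
Proof.
move=> [P [Pc PP PY]].
have PYx x : P x \in subspace_pred Y.
  by apply: mem_set; rewrite -PY; exists x.
pose t x := SubspaceType (PYx x).
have tl : linear t by move=> a x z; apply: val_inj => /=; rewrite linearP.
pose T : {linear X -> subspace_type Y} :=
  HB.pack t (GRing.isLinear.Build _ _ _ _ t tl).
exists T; split=> [x|x Yx].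
  by apply/cvgrPdist_lt => e e0; have /cvgrPdist_lt/(_ _ e0) := Pc x.
have [z _ zx] : range P x by rewrite PY.
by rewrite -[LHS]/(`|P x|) -zx PP.
Qed.

End subspace.

Theorem corollary3p5 (R : realType) (X : completeNormedModType R)
  (Xinf : ~ finite_dimensional X)
  (Xball : dual_ball_wstar_seq_compact X \/
    forall S : closed_subspace X, separable (subspace_type S) ->
      exists Y : closed_subspace X,
        [/\ S `<=` Y, complemented Y
          & dual_ball_wstar_seq_compact (subspace_type Y)]) :
  same_convex_differentiability (weak_compacts X) (norm_compacts X) <->
  schur_property X.
Proof.
split=> [same|schur f _ _ x]; last first.
  split; first exact: norm_compacts_differentiable.
  exact: schur_weak_compacts_differentiable.
apply: contrapT => /not_schur_sequence[y [e [e0 y0 ye]]].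
(* The second alternative is applied to the closed span of the sequence, so that [Y] contains every
   [y n] and the projection keeps their norms. *)
case: Xball => [Xseq|/(_ _ (separable_closed_span y))[Y [SY Ycompl Yseq]]].
  apply: (@not_same_convex_differentiability _ X X idfun y e) => //.
  by move=> x; exact: cvg_id.
have [T [Tc Tnorm]] := complemented_projection Ycompl.
apply: (not_same_convex_differentiability Yseq Tc e0 y0) same => n.
by rewrite Tnorm//; apply: SY; exact: closed_span_gen.
Qed.
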